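(* Let $\beta>\beta_c$ and let $(k_N)$ be a sequence of positive integers such that, as $N\to\infty$, $$k_N\uparrow\infty,\qquad \frac{k_N}{N}\uparrow\infty,\qquad \frac{(\log k_N)(\log N)}{N}\downarrow 0 .$$ Then $$\limsup_{N\uparrow\infty}\ \mu_{N,\beta}\big(\{(\tilde\sigma)_1,\ldots,(\tilde\sigma)_{k_N}\}^c\big)=0\qquad\text{almost surely.}$$
   Context: $\beta_c:=\sqrt{2\log 2}$. For each $N$, let $\{(\sigma)_i:1\le i\le 2^N\}$ be an enumeration of $\{-1,+1\}^N$ and let $(X_i)_{1\le i\le 2^N}$ (depending on $N$) be i.i.d. standard Gaussian random variables, $X_i$ attached to $(\sigma)_i$, all families being defined on one common probability space $(\Omega,\Sigma,\mathbb P)$. The Gibbs measure of the random energy model is the random probability measure on $\{-1,+1\}^N$ giving $(\sigma)_i$ the weight $e^{-\beta\sqrt N X_i}/\sum_{l=1}^{2^N}e^{-\beta\sqrt N X_l}$; it is denoted $\mu_{N,\beta}$. $X_{1,2^N}\le\cdots\le X_{2^N,2^N}$ are the order statistics of $(X_i)$, and $(\tilde\sigma)_j$ is the (a.s. unique) configuration $(\sigma)_i$ with $X_i=X_{j,2^N}$. *)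

(* Defs.v *)
From HB Require Import structures.
From mathcomp Require Import all_boot all_order all_algebra.
From mathcomp Require Import all_classical all_reals all_analysis.

Set Implicit Arguments.
Unset Strict Implicit.
Unset Printing Implicit Defensive.

Import Order.TTheory GRing.Theory Num.Theory.
Import numFieldNormedType.Exports.

Local Open Scope classical_set_scope.
Local Open Scope ring_scope.

Definition spin : finType := seq_sub [:: -1; 1 : int].

Definition config (N : nat) : finType := {ffun 'I_N -> spin}.

Definition beta_c (R : realType) : R := Num.sqrt (2 * ln 2).

Section probability.
Context d (T : measurableType d) (R : realType) (P : probability T R).

Definition mutually_independent (I : finType) (X : I -> {RV P >-> R}) : Prop :=
  forall (J : {set I}) (B : I -> set R),
    (forall i, i \in J -> measurable (B i)) ->
    P (\bigcap_(i in [set` J]) (X i @^-1` B i)) =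
      (\prod_(i in J) P (X i @^-1` B i))%E.

(* The laws are compared on measurable sets only: on other sets the values of
   [distribution P X] and [normal_prob 0 1] carry no meaning. *)
Definition standard_gaussian (X : {RV P >-> R}) : Prop :=
  forall A : set R, measurable A -> distribution P X A = normal_prob 0 1 A.

Definition iid_standard_gaussian (I : finType) (X : I -> {RV P >-> R}) : Prop :=
  mutually_independent X /\ (forall i, standard_gaussian (X i)).

End probability.

(* [sigma] is the enumeration of the configurations and [x] is one realization
   of the Gaussian family: the energy of [sigma i] is [x i]. *)
Section random_energy_model.
Context (R : realType) (N : nat).
Implicit Types (sigma : 'I_(2 ^ N) -> config N) (x : 'I_(2 ^ N) -> R).

Definition boltzmann (beta : R) x (i : 'I_(2 ^ N)) : R :=
  expR (- (beta * Num.sqrt N%:R * x i)).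

Definition gibbs (beta : R) sigma x (A : {set config N}) : R :=
  \sum_(i | sigma i \in A) (boltzmann beta x i / \sum_l boltzmann beta x l).

(* Ranks start at 0: the order statistic usually written X_{j+1,2^N} is
   [order_stat x j]. *)
Definition order_stat x (j : 'I_(2 ^ N)) : R :=
  nth 0 (sort <=%R [seq x i | i <- enum 'I_(2 ^ N)]) j.

Lemma order_stat_attained x j : exists i, x i == order_stat x j.
Proof.
have: order_stat x j \in sort <=%R [seq x i | i <- enum 'I_(2 ^ N)].
  by apply: mem_nth; rewrite size_sort size_map size_enum_ord.
by rewrite mem_sort => /mapP[i _ ->]; exists i.
Qed.

(* When several energies coincide (an event of probability zero), [xchoose]
   picks one of the configurations having the energy [order_stat x j]. *)
Definition ranked_config sigma x (j : 'I_(2 ^ N)) : config N :=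
  sigma (xchoose (order_stat_attained x j)).

(* If [2 ^ N < k], the ranks above [2 ^ N] are ignored. *)
Definition lowest_configs sigma x (k : nat) : {set config N} :=
  [set ranked_config sigma x j | j : 'I_(2 ^ N) & (j < k)%N].

End random_energy_model.

(* Main.v *)
Require Import Defs.
From HB Require Import structures.
From mathcomp Require Import all_boot all_order all_algebra.
From mathcomp Require Import all_classical all_reals all_analysis.
From mathcomp Require Import measurable_realfun ring lra zify.

Import Order.TTheory GRing.Theory Num.Theory.
Import numFieldNormedType.Exports.

Local Open Scope classical_set_scope.
Local Open Scope ring_scope.

Import HBNNSimple.

(** Write [lam] for [beta * sqrt N], so that the site [i] has Boltzmann weight
    exp (- lam * X_i), and [theta] for [beta / beta_c], which exceeds 1.  Fix two
    energy levels: [- a], which the ground state reaches, and the higher level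
    [- b], below which there are at most [k] sites.

    Let [cut_weight lam b x] be min(1, exp (- lam * (x + b))).  If its sum over all
    sites is at most [k], then two things follow at once.  Each site with energy
    at most [- b] contributes 1, so there are at most [k] of them and all of
    them are among the [k] lowest sites; and the Boltzmann weights of the
    other sites add up to at most k * exp (lam * b).  If moreover some site
    reaches [- a], the partition function is at least exp (lam * a), and the
    Gibbs mass of the complement is at most k * exp (- lam * (a - b)).  This is
    [gibbs_complement_le].

    The levels are a^2/2 = N ln 2 - (1/2 + eps) ln N and
    b^2/2 = N ln 2 - (1/2 - eps) ln N - ln k.  Both are at most [beta_c * sqrt N],
    hence lam * (a - b) >= theta * (a^2 - b^2) / 2 = theta * (ln k - 2 eps ln N).
    With eps = (theta - 1) / (4 theta) and k >= N, the mass of the complement is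
    at most N^(- (theta - 1) / 2), which tends to 0 ([complement_weight]).

    It remains to see that both conditions hold almost surely for large N.
    Gaussian tails give about N^eps expected sites below [- a]
    ([expected_ground]), so none is found there with probability at most
    exp (- c N^eps).  The expected sum of the cut weights is O(k N^(- eps))
    ([expected_cut]); its terms are independent and lie in [0, 1], so a Chernoff
    bound makes the probability that the sum reaches [k] at most exp (- k / 4).
    Both bounds are at most N^(- 2), and the first Borel-Cantelli lemma applies,
    whatever the joint law of the families for distinct N.
    The slack N^eps on both sides is affordable because [theta] is strictly
    greater than 1; the terms (1/2) ln N in the two levels must be kept, since
    an error of order ln N / 2 there could exceed (theta - 1) ln N. *)

(** * Expectation of a product of independent variables *)

Lemma measurable_preimage_RV d (T : measurableType d) (R : realType)
    (P : probability T R) (X : {RV P >-> R}) (B : set R) :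
  measurable B -> measurable (X @^-1` B).
Proof.
by move=> mB; rewrite -[X in measurable X]setTI; exact: (measurable_funP X).
Qed.

(** An identity between weighted integrals extends from indicator functions to
    nonnegative measurable functions: both sides are linear on simple functions
    and pass to monotone limits.  With [c = 1] it turns a density into an
    integration rule; with [c] an expectation it is the induction step of
    [expectation_prod_indep]. *)
Lemma ge0_integral_weighted_comp d (T : measurableType d) (R : realType)
    (mu : {measure set T -> \bar R}) (nu : {measure set R -> \bar R})
    (X : T -> R) (W : T -> R) (c : \bar R) (g : R -> R) :
  measurable_fun [set: T] X ->
  (forall t, 0 <= W t) -> measurable_fun [set: T] W ->
  (0 <= c)%E -> c \is a fin_num ->
  (forall B, measurable B -> \int[mu]_t (W t * \1_B (X t))%:E = c * nu B)%E ->
  (forall x, 0 <= g x) -> measurable_fun [set: R] g ->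
  (\int[mu]_t (W t * g (X t))%:E = c * \int[nu]_x (g x)%:E)%E.
Proof.
move=> mX W0 mW c0 cfin WX g0 mg.
have mg' : measurable_fun [set: R] (fun x => (g x)%:E) by apply/measurable_EFinP.
pose h := nnsfun_approx measurableT mg'.
have mhX n : measurable_fun [set: T] (fun t => h n (X t)).
  by apply: measurableT_comp.
have hg x : (h n x)%:E @[n --> \oo] --> (g x)%:E.
  by apply: (@cvg_nnsfun_approx _ _ _ _ measurableT _ mg') => // y _;
     rewrite lee_fin.
have hnd m n x : (m <= n)%N -> h m x <= h n x.
  by move=> mn; exact/lefP/nd_nnsfun_approx.
have -> : (\int[mu]_t (W t * g (X t))%:E =
   limn (fun n => \int[mu]_t (W t * h n (X t))%:E))%E.
  rewrite -monotone_convergence//.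
  - apply: eq_integral => t _; apply/esym/cvg_lim => //=.
    under eq_fun do rewrite EFinM.
    by rewrite EFinM; apply: cvgeZl => //; exact: hg.
  - by move=> n; apply/measurable_EFinP; apply: measurable_funM.
  - by move=> n t _; rewrite lee_fin mulr_ge0.
  - by move=> t _ m n mn; rewrite lee_fin ler_wpM2l// hnd.
have -> : (\int[nu]_x (g x)%:E = limn (fun n => \int[nu]_x (h n x)%:E))%E.
  rewrite -monotone_convergence//.
  - by apply: eq_integral => t _; apply/esym/cvg_lim => //=; exact: hg.
  - by move=> n; apply/measurable_EFinP.
  - by move=> n t _; rewrite lee_fin.
  - by move=> t _ m n mn; rewrite lee_fin hnd.
rewrite -limeMl//; last first.
  apply: ereal_nondecreasing_is_cvgn => m n mn.
  apply: ge0_le_integral => //.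
  - by move=> t _; rewrite lee_fin.
  - exact/measurable_EFinP.
  - exact/measurable_EFinP.
  - by move=> t _; rewrite lee_fin hnd.
congr (limn _); apply/funext => n.
have mI y : measurable_fun [set: T] (fun t => (\1_(h n @^-1` [set y]) (X t) : R)).
  by apply: (measurableT_comp (measurable_indic _)).
have rge0 y : y \in range (h n) -> 0 <= y by rewrite inE => -[t _ <-].
transitivity (\sum_(y \in range (h n))
    (\int[mu]_t (y%:E * (W t * \1_(h n @^-1` [set y]) (X t))%:E)))%E.
  rewrite -ge0_integral_fsum//.
  - apply: eq_integral => t _; rewrite fimfunE EFinM -fsumEFin//.
    rewrite ge0_mule_fsumr; last by move=> y; exact: nnfun_muleindic_ge0.
    by apply: eq_fsbigr => y _; rewrite -!EFinM mulrCA.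
  - by move=> y; apply/measurable_EFinP; do 2!apply: measurable_funM => //.
  - move=> y t _; rewrite muleC -EFinM -mulrA mulrC EFinM mulrC.
    by rewrite EFinM mule_ge0 ?lee_fin//; exact: nnfun_muleindic_ge0.
under [in RHS]eq_integral do rewrite fimfunE -fsumEFin//.
rewrite ge0_integral_fsum//; last 2 first.
  - by move=> y; apply/measurable_EFinP; apply: measurable_funM.
  - by move=> y t _; exact: nnfun_muleindic_ge0.
rewrite ge0_mule_fsumr; last first.
  by move=> y; apply: integral_ge0 => t _; exact: nnfun_muleindic_ge0.
apply: eq_fsbigr => y /rge0 y0.
rewrite ge0_integralZl//; last 2 first.
  - by apply/measurable_EFinP; apply: measurable_funM.
  - by move=> t _; rewrite lee_fin mulr_ge0.
rewrite WX//; under [in RHS]eq_integral do rewrite EFinM.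
rewrite ge0_integralZl//; last exact/measurable_EFinP.
by rewrite muleCA integral_indic ?setIT.
Qed.

(** Independence is the case where all the [h i] are indicators.  General
    functions replace indicators one index at a time: with the other factors
    fixed, [ge0_integral_weighted_comp] handles the index being freed. *)
Lemma expectation_prod_indep d (T : measurableType d) (R : realType)
    (P : probability T R) (I : finType) (X : I -> {RV P >-> R})
    (h : I -> R -> R) :
  mutually_independent X ->
  (forall i x, 0 <= h i x) -> (forall i, measurable_fun [set: R] (h i)) ->
  (forall i, (\int[P]_t (h i (X i t))%:E)%E \is a fin_num) ->
  (\int[P]_t (\prod_i h i (X i t))%:E =
   \prod_i \int[P]_t (h i (X i t))%:E)%E.
Proof.
move=> indepX.
have intI i (B : set R) : measurable B ->
    (\int[P]_t (\1_B (X i t))%:E = P (X i @^-1` B))%E.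
  move=> mB; have mXB := measurable_preimage_RV _ _ _ _ (X i) _ mB.
  rewrite (eq_integral (fun t => (\1_(X i @^-1` B) t)%:E))//.
  by rewrite integral_indic ?setIT.
(* [s] lists the indices at which [h] is no longer an indicator. *)
suff claim (s : seq I) : forall h : I -> R -> R,
    (forall i x, 0 <= h i x) -> (forall i, measurable_fun [set: R] (h i)) ->
    (forall i, (\int[P]_t (h i (X i t))%:E)%E \is a fin_num) ->
    (forall i, i \notin s -> exists2 B, measurable B & h i = \1_B) ->
  (\int[P]_t (\prod_i h i (X i t))%:E =
   \prod_i \int[P]_t (h i (X i t))%:E)%E.
  move=> h0 mh hfin; apply: (claim (enum I)) => // i.
  by rewrite mem_enum.
elim: s => [|j s IHs] {}h h0 mh hfin hind.
  have /boolp.choice[B hB] : forall i, exists B, measurable B /\ h i = \1_B.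
    by move=> i; have [B mB hB] := hind i isT; exists B.
  have mB i : measurable (B i) by have [] := hB i.
  have hE i : h i = \1_(B i) by have [] := hB i.
  have mXB i : measurable (X i @^-1` B i) by exact: measurable_preimage_RV.
  transitivity (P (\bigcap_(i in [set` [set: I]%SET]) (X i @^-1` B i))).
    rewrite (eq_integral (fun t =>
      (\1_(\bigcap_(i in [set` [set: I]%SET]) (X i @^-1` B i)) t)%:E)).
      rewrite integral_indic ?setIT//.
      by apply: fin_bigcap_measurable.
    move=> t _; congr (_%:E); rewrite indicE.
    have [tB|tB] := boolP (t \in _).
      rewrite big1// => i _; rewrite hE indicE mem_set//.
      by move: tB; rewrite inE => /(_ i); apply; rewrite /= inE.
    have : ~ forall i, B i (X i t).
      by move=> A; move/negP: tB; apply; rewrite inE => i _; exact: A.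
    move=> /existsNP[i nB].
    by rewrite (bigD1 i)//= hE indicE memNset ?mul0r.
  rewrite indepX//; under eq_bigl do rewrite inE.
  by apply: eq_bigr => i _; rewrite -intI// hE.
have h'E (g : R -> R) t :
    \prod_i (if i == j then g else h i) (X i t) =
    (\prod_(i | i != j) h i (X i t)) * g (X j t).
  rewrite (bigD1 j)//= eqxx mulrC; congr (_ * _).
  by apply: eq_bigr => i /negbTE ->.
have EE (g : R -> R) :
    (\prod_i \int[P]_t ((if i == j then g else h i) (X i t))%:E =
    (\prod_(i | i != j) \int[P]_t (h i (X i t))%:E) *
      \int[P]_t (g (X j t))%:E)%E.
  rewrite (bigD1 j)//= eqxx muleC; congr (_ * _)%E.
  by apply: eq_bigr => i /negbTE ->.
have hjj i : (if i == j then h j else h i) = h i by case: eqP => // ->.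
transitivity (\int[P]_t
    ((\prod_(i | i != j) h i (X i t)) * h j (X j t))%:E)%E.
  by apply: eq_integral => t _; rewrite -h'E; congr (_%:E);
     apply: eq_bigr => i _; rewrite hjj.
have Edist (g : R -> R) : (forall x, 0 <= g x) -> measurable_fun [set: R] g ->
    (\int[distribution P (X j)]_x (g x)%:E = \int[P]_t (g (X j t))%:E)%E.
  by move=> g0 mg; rewrite ge0_integral_distribution//; exact/measurable_EFinP.
rewrite (@ge0_integral_weighted_comp _ _ _ P (distribution P (X j)) (X j) _
  (\prod_(i | i != j) \int[P]_t (h i (X i t))%:E)%E)//.
- by rewrite Edist// -EE; apply: eq_bigr => i _; rewrite hjj.
- by move=> t; apply: prodr_ge0.
- under eq_fun do rewrite -big_filter.
  by apply: (measurable_prod (h := fun i t => h i (X i t))) => i _; apply: measurableT_comp.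
- by apply: prode_ge0 => i _; apply: integral_ge0 => t _; rewrite lee_fin.
- apply: (big_ind (fun x : \bar R => x \is a fin_num)) => // x y xf yf.
  by rewrite fin_numM.
- move=> B mB; transitivity ((\prod_(i | i != j) \int[P]_t (h i (X i t))%:E) *
      \int[P]_t (\1_B (X j t))%:E)%E; last by rewrite intI.
  rewrite -EE -(IHs (fun i => if i == j then \1_B else h i)).
  + by apply: eq_integral => t _; rewrite h'E.
  + by move=> i x; case: ifP.
  + by move=> i; case: ifP.
  + move=> i; case: ifP => _; last exact: hfin.
    by rewrite intI// fin_num_measure//; exact: measurable_preimage_RV.
  + move=> i si; case: ifPn => [_|ij]; first by exists B.
    by apply: hind; rewrite inE negb_or ij.
Qed.

(** * Large deviations, minimum and ties of an independent family *)

(** Multiply by exp (- x / 2) >= 1 - x / 2 and use (1 + x) (1 - x / 2) >= 1 on [0, 1]. *)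
Lemma expR_half_le (R : realType) (x : R) : 0 <= x <= 1 -> expR (x / 2) <= 1 + x.
Proof.
move=> /andP[x0 x1].
have h : 1 - x / 2 <= expR (- (x / 2)) by have := expR_ge1Dx (- (x / 2)).
have e0 := expR_gt0 (x / 2).
have : expR (x / 2) * (1 - x / 2) <= 1.
  by rewrite -[leRHS](expRxMexpNx_1 (x / 2)) ler_wpM2l// ltW.
move=> h2; have q : 1 <= (1 + x) * (1 - x / 2) by nra.
have p : 0 < 1 - x / 2 by lra.
by rewrite -(ler_pM2r p) (le_trans h2).
Qed.

Lemma ge0_lee_prod (R : realType) (I : finType) (u v : I -> \bar R) :
  (forall i, 0 <= u i <= v i)%E -> (\prod_i u i <= \prod_i v i)%E.
Proof.
move=> uv; suff : (0 <= \prod_i u i <= \prod_i v i)%E by move=> /andP[].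
apply: (big_ind2 (fun x y : \bar R => 0 <= x <= y)%E) => //; first by rewrite lee01 lexx.
move=> x x' y y' /andP[x0 xx'] /andP[y0 yy'].
by rewrite mule_ge0//= lee_pmul.
Qed.

Lemma measurable_sum_ge d (T : measurableType d) (R : realType)
    (P : probability T R) (I : finType) (X : I -> {RV P >-> R})
    (f : R -> R) (K : R) :
  measurable_fun [set: R] f ->
  measurable [set t | K <= \sum_i f (X i t)].
Proof.
move=> mf.
have mS : measurable_fun [set: T] (fun t => \sum_i f (X i t)).
  by apply: measurable_sum => i; exact: measurableT_comp.
have -> : [set t | K <= \sum_i f (X i t)] =
    [set: T] `&` (fun t => \sum_i f (X i t)) @^-1` `[K, +oo[.
  by rewrite setTI; apply/seteqP; split => t; rewrite /= in_itv /= andbT.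
exact: mS.
Qed.

(** Markov's inequality for the product of the 1 + f (X_i): it is at least
    exp (K / 2) when the sum reaches [K], by [expR_half_le], and its expectation
    is at most (1 + e)^#|I|. *)
Lemma chernoff_sum d (T : measurableType d) (R : realType)
    (P : probability T R) (I : finType) (X : I -> {RV P >-> R})
    (f : R -> R) (e K : R) :
  mutually_independent X ->
  measurable_fun [set: R] f -> (forall x, 0 <= f x <= 1) ->
  (forall i, \int[P]_t (f (X i t))%:E <= e%:E)%E ->
  (P [set t | (K <= \sum_i f (X i t))%R] <= (expR (#|I|%:R * e - K / 2))%:E)%E.
Proof.
move=> indepX mf f01 Ef.
have f0 x : 0 <= f x by have /andP[] := f01 x.
have f1 x : f x <= 1 by have /andP[] := f01 x.
have mfX i : measurable_fun [set: T] (fun t => f (X i t)).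
  exact: measurableT_comp.
pose A := [set t | (K <= \sum_i f (X i t))%R].
have mA : measurable A by exact: measurable_sum_ge.
have mg : measurable_fun [set: R] (fun x => 1 + f x) by exact: measurable_funD.
have Eg i : (\int[P]_t (1 + f (X i t))%:E = 1 + \int[P]_t (f (X i t))%:E)%E.
  under eq_integral do rewrite EFinD.
  rewrite ge0_integralD//.
  - by rewrite integral_cst//= probability_setT mule1.
  - by move=> t _; rewrite lee_fin.
  - exact/measurable_EFinP.
have mW : measurable_fun [set: T] (fun t => \prod_i (1 + f (X i t))).
  by apply: (measurable_prod (h := fun i t => 1 + f (X i t))) => i _;
    exact: measurable_funD.
have Efin i : (\int[P]_t (f (X i t))%:E)%E \is a fin_num.
  rewrite ge0_fin_numE; first exact: le_lt_trans (Ef i) (ltry _).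
  by apply: integral_ge0 => t _; rewrite lee_fin.
have key : ((expR (K / 2))%:E * P A <= (expR (#|I|%:R * e))%:E)%E.
  have -> : P A = (\int[P]_t (\1_A t)%:E)%E by rewrite integral_indic// setIT.
  rewrite -ge0_integralZl//; last first.
    exact/measurable_EFinP/measurable_indic.
  apply: (@le_trans _ _ (\int[P]_t (\prod_i (1 + f (X i t)))%:E)%E).
    apply: ge0_le_integral => //.
    - by apply/measurable_EFinP; apply: measurable_funM.
    - exact/measurable_EFinP.
    - move=> t _; rewrite -EFinM lee_fin indicE.
      have [tA|_] := boolP (t \in A); last first.
        by rewrite mulr0 prodr_ge0// => i _; rewrite addr_ge0.
      rewrite mulr1; apply: (@le_trans _ _ (expR (\sum_i f (X i t) / 2))).
        by rewrite ler_expR -mulr_suml ler_pM2r//; move: tA; rewrite inE.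
      rewrite expR_sum; apply: ler_prod => i _.
      by rewrite expR_ge0 expR_half_le.
  rewrite (@expectation_prod_indep _ _ _ _ _ X (fun _ x => 1 + f x))//; last 2 first.
  - by move=> i x; rewrite addr_ge0.
  - by move=> i; rewrite Eg fin_numD/= Efin.
  have -> : expR (#|I|%:R * e) = \prod_(i : I) expR e.
    by rewrite prodr_const expRM_natl.
  rewrite -prodEFin; apply: ge0_lee_prod => i.
  rewrite integral_ge0/=; last by move=> t _; rewrite lee_fin addr_ge0.
  rewrite Eg.
  rewrite (@le_trans _ _ (1 + e%:E)%E) ?leeD2l//.
  by rewrite -EFinD lee_fin expR_ge1Dx.
by rewrite expRD expRN mulrC EFinM lee_pdivlMl ?expR_gt0.
Qed.

Lemma prob_all_gt d (T : measurableType d) (R : realType)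
    (P : probability T R) (I : finType) (X : I -> {RV P >-> R}) (a p : R) :
  mutually_independent X ->
  (forall i, p%:E <= P (X i @^-1` `]-oo, a]))%E ->
  (P (\bigcap_(i in [set` [set: I]%SET]) (X i @^-1` `]a, +oo[)) <=
    (expR (- (#|I|%:R * p)))%:E)%E.
Proof.
move=> indepX hp; rewrite indepX//; under eq_bigl do rewrite inE.
have -> : expR (- (#|I|%:R * p)) = \prod_(i : I) expR (- p).
  by rewrite prodr_const -mulrN expRM_natl.
rewrite -prodEFin; apply: ge0_lee_prod => i; rewrite measure_ge0/=.
have -> : X i @^-1` `]a, +oo[ = ~` (X i @^-1` `]-oo, a]).
  by rewrite preimage_setC setCitvl.
rewrite probability_setC; last exact: measurable_preimage_RV.
apply: (@le_trans _ _ (1 - p%:E)%E); first by rewrite leeB.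
by rewrite -EFinB lee_fin expR_ge1Dx.
Qed.

(** The joint law of [X i] and [X j] is a product measure, and each vertical
    section of the diagonal is a point, which has Gaussian measure zero. *)
Lemma prob_tie d (T : measurableType d) (R : realType)
    (P : probability T R) (I : finType) (X : I -> {RV P >-> R}) (i j : I) :
  iid_standard_gaussian X -> i != j -> P [set t | X i t = X j t] = 0%E.
Proof.
move=> [indepX gX] ij.
pose XY t := (X i t, X j t).
have mXY : measurable_fun [set: T] XY by exact: measurable_fun_pair.
pose mu l : probability R R := distribution P (X l).
pose D : set (R * R) := [set p | p.1 = p.2].
have mD : measurable D.
  have -> : D = [set: R * R] `&` (fun p => p.1 - p.2) @^-1` [set 0].
    rewrite setTI; apply/seteqP; split => -[x y]; rewrite /D /=.
      by move=> ->; rewrite subrr.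
    by move/subr0_eq.
  have m : measurable_fun [set: R * R] (fun p : R * R => p.1 - p.2).
    by apply: measurable_funB.
  exact: m.
have -> : P [set t | X i t = X j t] = pushforward P XY D by [].
rewrite -(@product_measure_unique _ _ _ _ _ (mu i) (mu j) (pushforward P XY))//.
- rewrite /product_measure1 /= integral0_eq// => x _ /=.
  have -> : xsection D x = [set x].
    by apply/seteqP; split => y; rewrite /xsection/= inE.
  rewrite [LHS](gX j)//.
  have := @normal_prob_dominates R 0 1 => /null_content_dominatesP.
  by apply => //; exact: lebesgue_measure_set1.
- move=> A B mA mB.
  pose C l := if l == i then A else B.
  have := indepX [set i; j]%SET C.
  rewrite (bigD1 i)/= ?inE ?eqxx// (bigD1 j)/= ?inE ?eqxx ?orbT//=; last by rewrite eq_sym.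
  rewrite big1 ?mule1; last first.
    by move=> l; rewrite !inE => /andP[/andP[/orP[]/eqP->]]; rewrite eqxx.
  rewrite /C eqxx eq_sym (negbTE ij) => <-.
  + congr (P _); apply/seteqP; split => t /=.
      move=> [At Bt] l /=; rewrite !inE => /orP[] /eqP ->; rewrite ?eqxx//.
      by rewrite eq_sym (negbTE ij).
    move=> h; split.
      by have := h i; rewrite /= !inE eqxx; apply.
    by have := h j; rewrite /= !inE eqxx orbT eq_sym (negbTE ij); apply.
  + by move=> l _; case: ifP.
Qed.

(** * Gaussian estimates *)

Lemma integral_expR_ray (R : realType) (c a : R) : 0 < c ->
  (\int[lebesgue_measure]_(x in `[a, +oo[) (expR (- (c * (x - a))))%:E =
   (c^-1)%:E)%E.
Proof.
move=> c0.
pose f (x : R) := expR (- (c * (x - a))).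
pose F (x : R) := - (c^-1 * f x).
have df (x : R) : is_derive x 1 f (- c * f x).
  have dg : is_derive x (1 : R) (fun x : R => - (c * (x - a))) (- c).
    by apply: is_derive_eq; rewrite /GRing.scale/= subr0 mulr1.
  have := @is_derive1_comp R expR (fun x : R => - (c * (x - a))) x _ _ (is_derive_expR _) dg.
  by rewrite /GRing.scale/= mulrC.
have dF (x : R) : is_derive x 1 F (f x).
  rewrite /F; apply: is_derive_eq.
  by rewrite /GRing.scale/= mulNr mulrN opprK mulrA mulVf ?mul1r// gt_eqF.
have cf : continuous f.
  by move=> x; apply/differentiable_continuous/derivable1_diffP; have [] := df x.
have cF : continuous F.
  by move=> x; apply/differentiable_continuous/derivable1_diffP; have [] := dF x.
rewrite (@ge0_continuous_FTC2y _ f F a 0)//.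
- by rewrite /F /f subrr mulr0 oppr0 expR0 mulr1 EFinN oppeK add0e.
- by move=> x _; exact: expR_ge0.
- exact: continuous_subspaceT.
- rewrite -[X in _ --> X]oppr0; apply: cvgN.
  rewrite -[X in _ --> X](mulr0 c^-1); apply: cvgM; first exact: cvg_cst.
  rewrite /f; apply: (@cvg_comp _ _ _ (fun x => c * (x - a)) (fun y => expR (- y))
    _ (pinfty_nbhs R)); last exact: cvgr_expR.
  apply: gt0_cvgMry => //.
  exact: cvg_addrr.
- by apply: cvg_at_right_filter; exact: cF.
- by move=> x _; rewrite derive1E; apply: derive_val.
Qed.

Lemma normal_pdf01E (R : realType) (x : R) :
  normal_pdf 0 1 x = normal_peak 1 * expR (- x ^+ 2 / 2).
Proof.
by rewrite normal_pdfE ?oner_neq0// /normal_fun subr0 expr1n.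
Qed.

Lemma normal_peak1_le1 (R : realType) : normal_peak (1 : R) <= 1.
Proof.
rewrite /normal_peak expr1n mul1r invf_le1.
  rewrite -[leLHS]sqrtr1 ler_wsqrtr//.
  have := @pi_ge2 R; lra.
rewrite sqrtr_gt0; have := @pi_ge2 R; lra.
Qed.

Lemma gaussian_expectation d (T : measurableType d) (R : realType)
    (P : probability T R) (X : {RV P >-> R}) (f : R -> R) :
  standard_gaussian X -> (forall x, 0 <= f x) -> measurable_fun [set: R] f ->
  (\int[P]_t (f (X t))%:E =
   \int[lebesgue_measure]_x (normal_pdf 0 1 x * f x)%:E)%E.
Proof.
move=> gX f0 mf.
rewrite (@ge0_integral_weighted_comp _ _ _ lebesgue_measure (distribution P X) id _ 1%E)//.
- rewrite mul1e ge0_integral_distribution//; exact/measurable_EFinP.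
- by move=> x; exact: normal_pdf_ge0.
- exact: measurable_normal_pdf.
- move=> B mB; rewrite mul1e; transitivity (normal_prob 0 1 B); last exact/esym/gX.
  rewrite [RHS]integral_mkcond; apply: eq_integral => x _.
  by rewrite EFinM epatch_indic.
Qed.

(** Equal to 1 on energies up to [- b], and to the Boltzmann weight relative to
    that of the level [- b] above it. *)
Definition cut_weight {R : realType} (lam b x : R) : R :=
  Num.min 1 (expR (- (lam * (x + b)))).

Lemma cut_weight_ge0 (R : realType) (lam b x : R) : 0 <= cut_weight lam b x.
Proof. by rewrite /cut_weight le_min ler01 expR_ge0. Qed.

Lemma cut_weight_le1 (R : realType) (lam b x : R) : cut_weight lam b x <= 1.
Proof. by rewrite /cut_weight ge_min lexx. Qed.

Lemma measurable_cut_weight (R : realType) (lam b : R) :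
  measurable_fun [set: R] (cut_weight lam b).
Proof.
apply: measurable_minr => //; apply: measurableT_comp => //.
apply: measurableT_comp => //; apply: measurable_funM => //.
exact: measurable_funD.
Qed.

(** The expansion of (x + b)^2 >= 0 gives
    exp (- x^2 / 2) <= exp (- b^2 / 2) exp (b (x + b)).  Up to the constant
    exp (- b^2 / 2), the integrand thus decays exponentially away from [- b], with
    rate [b] on the left and [lam - b] on the right. *)
Lemma gaussian_cut_weight d (T : measurableType d) (R : realType)
    (P : probability T R) (X : {RV P >-> R}) (lam b : R) :
  standard_gaussian X -> 0 < b -> b < lam ->
  (\int[P]_t (cut_weight lam b (X t))%:E <=
    (expR (- b ^+ 2 / 2) * (b^-1 + (lam - b)^-1))%:E)%E.
Proof.
move=> gX b0 blam.
pose f : R -> R := cut_weight lam b.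
have f0 x : 0 <= f x by exact: cut_weight_ge0.
have ce (c y : R) : continuous (fun x : R => expR (- (c * (x + y)))).
  move=> x; apply: (@continuous_comp _ _ _ (fun x : R => - (c * (x + y))) expR).
    apply: cvgN; apply: cvgM; first exact: cvg_cst.
    by apply: cvgD; [exact: cvg_id|exact: cvg_cst].
  exact: continuous_expR.
have me (c y : R) : measurable_fun [set: R] (fun x : R => expR (- (c * (x + y)))).
  exact: continuous_measurable_fun.
have mf : measurable_fun [set: R] f by exact: measurable_cut_weight.
rewrite (@gaussian_expectation _ _ _ _ X f)//.
pose K := expR (- b ^+ 2 / 2).
have Ke (x : R) : expR (- x ^+ 2 / 2) <= K * expR (b * (x + b)).
  rewrite -expRD ler_expR; have := sqr_ge0 (x + b); rewrite sqrrD. nra.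
have phi0 x : 0 <= normal_pdf 0 1 x :> R by exact: normal_pdf_ge0.
have phiK x : normal_pdf 0 1 x <= K * expR (b * (x + b)).
  rewrite normal_pdf01E; apply: le_trans (Ke x).
  by rewrite ler_piMl ?expR_ge0// normal_peak1_le1.
have line_split : [set: R] = `]-oo, -b] `|` `]-b, +oo[.
  by rewrite -setCitvl setUv.
have mphif : measurable_fun [set: R] (fun x : R => normal_pdf 0 1 x * f x).
  by apply: measurable_funM => //; exact: measurable_normal_pdf.
rewrite line_split ge0_integral_setU//=; first last.
- rewrite -setCitvl; exact/disj_setPCl.
- by move=> x _; rewrite lee_fin mulr_ge0.
- by rewrite -line_split; apply/measurable_EFinP.
rewrite mulrDr EFinD; apply: leeD.
- apply: (@le_trans _ _ (\int[lebesgue_measure]_(x in `]-oo, (- b)%R]) (K * expR (- (- b * (x + b))))%:E)%E).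
    apply: ge0_le_integral => //.
    + by move=> x _; rewrite lee_fin mulr_ge0.
    + by apply/measurable_EFinP; apply: measurable_funTS.
    + apply/measurable_EFinP; apply: measurable_funTS.
      by apply: measurable_funM => //; exact: me.
    + move=> x _; rewrite lee_fin mulNr opprK; apply: le_trans (phiK x).
      by rewrite ler_piMr// /f ge_min lexx.
  rewrite (ge0_integration_by_substitutionNy (G := fun x => K * expR (- (- b * (x + b))))).
  + under eq_integral => x _.
      rewrite /= EFinM (_ : - (- b * (- x + b)) = - (b * (x - b))); last by ring.
      over.
    rewrite ge0_integralZl//.
    * by rewrite integral_expR_ray.
    * apply/measurable_EFinP; apply: measurable_funTS.
      exact: continuous_measurable_fun (ce _ _).
    * by rewrite lee_fin expR_ge0.
  + apply: continuous_subspaceT => x; apply: cvgM; first exact: cvg_cst.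
    exact: ce.
  + by move=> x _; rewrite mulr_ge0 ?expR_ge0.
- apply: (@le_trans _ _ (\int[lebesgue_measure]_(x in `[(- b)%R, +oo[) (K * expR (- ((lam - b) * (x - (- b)))))%:E)%E).
    rewrite -integral_itv_obnd_cbnd//; last first.
      apply/measurable_EFinP; apply: measurable_funTS.
      exact: measurable_funM.
    apply: ge0_le_integral => //.
    + by move=> x _; rewrite lee_fin mulr_ge0.
    + by apply/measurable_EFinP; apply: measurable_funTS.
    + by apply/measurable_EFinP; apply: measurable_funTS; apply: measurable_funM => //; exact: me.
    + move=> x _; rewrite lee_fin opprK.
      apply: (@le_trans _ _ (K * expR (b * (x + b)) * expR (- (lam * (x + b))))).
        by apply: ler_pM => //; rewrite /f /cut_weight ge_min lexx orbT.
      by rewrite -mulrA -expRD ler_wpM2l ?expR_ge0// ler_expR; nra.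
  under eq_integral do rewrite EFinM.
  rewrite ge0_integralZl//.
  + by rewrite integral_expR_ray// subr_gt0.
  + by apply/measurable_EFinP; apply: measurable_funTS; exact: me.
  + by rewrite lee_fin expR_ge0.
Qed.

(** The interval of length 1 / a to the left of [- a] suffices: there x^2 / 2
    exceeds a^2 / 2 by at most 1 + 1 / (2 a^2) <= 2. *)
Lemma gaussian_lower_tail d (T : measurableType d) (R : realType)
    (P : probability T R) (X : {RV P >-> R}) (a : R) :
  standard_gaussian X -> 1 <= a ->
  ((normal_peak 1 * expR (- 2) * (expR (- a ^+ 2 / 2) / a))%:E <=
    P (X @^-1` `]-oo, (- a)%R]))%E.
Proof.
move=> gX a1.
have a0 : 0 < a by lra.
have -> : P (X @^-1` `]-oo, - a]) = normal_prob 0 1 `]-oo, - a].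
  by rewrite -gX.
pose m := normal_peak 1 * expR (- (a + a^-1) ^+ 2 / 2).
have m0 : 0 <= m by rewrite mulr_ge0 ?normal_peak_ge0 ?expR_ge0.
apply: (@le_trans _ _ (\int[lebesgue_measure]_(x in `[(- a - a^-1)%R, (- a)%R]) m%:E)%E).
  rewrite integral_cst//= lebesgue_measure_itv/= lte_fin ifT; last first.
    by rewrite ltrBlDr ltrDl invr_gt0.
  rewrite -EFinD -EFinM lee_fin.
  rewrite (_ : - a - (- a - a^-1) = a^-1); last by ring.
  rewrite mulrA ler_pM2r ?invr_gt0// /m -mulrA ler_wpM2l ?normal_peak_ge0//.
  rewrite -expRD ler_expR.
  have h1 : a^-1 <= 1 by rewrite invf_le1.
  have h0 : 0 < a^-1 by rewrite invr_gt0.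
  have e : a * a^-1 = 1 by rewrite mulfV ?gt_eqF.
  rewrite sqrrD e; nra.
rewrite /normal_prob.
apply: (@le_trans _ _ (\int[lebesgue_measure]_(x in `[(- a - a^-1)%R, (- a)%R]) (normal_pdf 0 1 x)%:E)%E).
  apply: ge0_le_integral => //.
  - by apply/measurable_EFinP/measurable_funTS; exact: measurable_normal_pdf.
  - move=> x /=; rewrite in_itv/= => /andP[x1 x2].
    rewrite lee_fin normal_pdf01E ler_wpM2l ?normal_peak_ge0// ler_expR.
    have h0 : 0 < a^-1 by rewrite invr_gt0.
    nra.
apply: ge0_subset_integral => //.
- by apply/measurable_EFinP/measurable_funTS; exact: measurable_normal_pdf.
- by move=> x _; rewrite lee_fin normal_pdf_ge0.
- by move=> x /=; rewrite !in_itv/= => /andP[].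
Qed.

(** * Gibbs mass of the complement for a fixed realization *)

(** The rank of [x i] in the sorted energies is less than the number of sites
    with energy at most [x i]; injectivity makes [i] the only site of that
    energy, hence the one chosen at that rank. *)
Lemma low_energy_ranked (R : realType) (N : nat) (sigma : 'I_(2 ^ N) -> config N)
    (x : 'I_(2 ^ N) -> R) (k : nat) (i : 'I_(2 ^ N)) :
  injective x -> (#|[set l | (x l <= x i)%R]%SET| <= k)%N ->
  sigma i \in lowest_configs sigma x k.
Proof.
move=> injx cardk.
pose s := sort <=%R [seq x l | l <- enum 'I_(2 ^ N)].
have xis : x i \in s by rewrite mem_sort map_f// mem_enum.
have ss : size s = (2 ^ N)%N by rewrite size_sort size_map size_enum_ord.
have ltj : (index (x i) s < 2 ^ N)%N by rewrite -ss index_mem.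
have sors : sorted <=%R s by apply: sort_sorted; exact: le_total.
pose j := Ordinal ltj.
have jE : order_stat x j = x i by rewrite /order_stat /= -/s nth_index.
apply/imsetP; exists j; last first.
  rewrite /ranked_config; congr (sigma _); apply: injx.
  by rewrite (eqP (xchooseP (order_stat_attained x j))) jE.
rewrite inE /=; apply: leq_trans cardk.
have -> : #|[set l | (x l <= x i)%R]%SET| = count (fun y => (y <= x i)%R) s.
  rewrite cardE size_filter (permP (permEl (perm_sort _ _))) count_map.
  rewrite enumT; apply: eq_count => l /=.
  by rewrite inE.
rewrite -[in leqRHS](cat_take_drop (index (x i) s).+1 s) count_cat.
apply: leq_trans (leq_addr _ _).
have -> : count (fun y => (y <= x i)%R) (take (index (x i) s).+1 s) =
    size (take (index (x i) s).+1 s).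
  apply/eqP; rewrite -all_count; apply/(all_nthP 0) => m.
  rewrite size_takel ?ss//.
  move=> mj; rewrite nth_take//.
  rewrite -[leRHS](nth_index 0 xis).
  apply: (sorted_leq_nth le_trans le_refl 0 sors); rewrite ?inE ?index_mem//.
  by apply: (@leq_ltn_trans (index (x i) s)); rewrite ?index_mem.
by rewrite size_takel ?ss.
Qed.

(** The bound on the cut weights controls both the number of sites with energy
    at most [- b] and the total Boltzmann weight of the others. *)
Lemma gibbs_complement_le (R : realType) (N : nat) (beta a b : R)
    (sigma : 'I_(2 ^ N) -> config N) (x : 'I_(2 ^ N) -> R) (k : nat) :
  let lam := beta * Num.sqrt N%:R in
  0 <= lam -> injective x ->
  \sum_i cut_weight lam b (x i) <= k%:R ->
  (exists i, x i <= - a) ->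
  gibbs beta sigma x (~: lowest_configs sigma x k)%SET <=
    k%:R * expR (- (lam * (a - b))).
Proof.
move=> lam lam0 injx sumf [i0 xi0].
have f0 i : 0 <= cut_weight lam b (x i) by exact: cut_weight_ge0.
have f1 i : x i <= - b -> cut_weight lam b (x i) = 1.
  move=> xb; rewrite /cut_weight; apply: min_l.
  by rewrite -[leLHS]expR0 ler_expR oppr_ge0 mulr_ge0_le0//; lra.
have f2 i : - b < x i -> cut_weight lam b (x i) = expR (- (lam * (x i + b))).
  move=> xb; rewrite /cut_weight; apply: min_r.
  by rewrite -[leRHS]expR0 ler_expR oppr_le0 mulr_ge0//; lra.
have low i : x i <= - b -> sigma i \in lowest_configs sigma x k.
  move=> xib; apply: low_energy_ranked => //.
  rewrite -(ler_nat R); apply: le_trans sumf.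
  rewrite -sumr_const [leRHS](bigID (mem [set l | (x l <= x i)%R]%SET))/=.
  rewrite ler_wpDr ?sumr_ge0//; apply: ler_sum => l; rewrite inE => xl.
  by rewrite f1// (le_trans xl).
have b0 i : 0 < boltzmann beta x i by exact: expR_gt0.
set Z := \sum_l boltzmann beta x l.
have Zge : expR (lam * a) <= Z.
  rewrite /Z (bigD1 i0)//= ler_wpDr//; first by apply: sumr_ge0 => l _; rewrite ltW.
  by rewrite /boltzmann -/lam ler_expR -mulrN ler_wpM2l//; lra.
have Z0 : 0 < Z by apply: lt_le_trans Zge; exact: expR_gt0.
rewrite /gibbs -/Z -mulr_suml.
apply: (@le_trans _ _ ((expR (lam * b) * k%:R) / Z)).
  rewrite ler_pM2r ?invr_gt0//.
  apply: (@le_trans _ _ (expR (lam * b) * \sum_i cut_weight lam b (x i))); last first.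
    by rewrite ler_wpM2l// expR_ge0.
  rewrite mulr_sumr [leRHS](bigID (fun i => sigma i \in (~: lowest_configs sigma x k)%SET))/=.
  rewrite ler_wpDr//; first by apply: sumr_ge0 => i _; rewrite mulr_ge0// expR_ge0.
  apply: ler_sum => i; rewrite inE => inb.
  have xib : - b < x i by rewrite ltNge; apply: contra inb => /low.
  rewrite f2// /boltzmann -/lam -expRD ler_expR.
  by rewrite le_eqVlt; apply/orP; left; apply/eqP; ring.
rewrite ler_pdivrMr//.
apply: (@le_trans _ _ (k%:R * expR (- (lam * (a - b))) * expR (lam * a))); last first.
  by rewrite ler_wpM2l// mulr_ge0// expR_ge0.
rewrite -mulrA -expRD mulrC.
by rewrite (_ : - (lam * (a - b)) + lam * a = lam * b)//; ring.
Qed.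

(** * Almost sure events *)

(** After a shift of the index by at least two, 1 / N^2 is dominated by the
    telescoping series of 1 / (n + 1) - 1 / (n + 2). *)
Lemma borel_cantelli_inv_sqr d (T : measurableType d) (R : realType)
    (P : probability T R) (A : nat -> set T) (c : R) :
  (forall N, measurable (A N)) ->
  (\forall N \near \oo, (P (A N) <= (c / N%:R ^+ 2)%:E)%E) ->
  \forall t \ae P, \forall N \near \oo, ~ A N t.
Proof.
move=> mA [N0 _ PA].
pose F n := A (n + N0.+2)%N.
have mF n : measurable (F n) by exact: mA.
have c0 : 0 <= c.
  have := PA N0.+1; rewrite /= => /(_ (leqnSn _)).
  by move=> /(le_trans (measure_ge0 _ _)); rewrite lee_fin pmulr_lge0// invr_gt0 exprn_gt0.
have FE n : (P (F n) <= (c * (n.+1%:R^-1 - n.+2%:R^-1))%:E)%E.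
  apply: (le_trans (PA _ _)); first by rewrite /=; lia.
  rewrite lee_fin ler_wpM2l//.
  rewrite (_ : n.+1%:R^-1 - n.+2%:R^-1 = (n.+1%:R * n.+2%:R)^-1 :> R); last first.
    have gen (x : R) : x != 0 -> x + 1 != 0 -> x^-1 - (x + 1)^-1 = (x * (x + 1))^-1.
      by move=> x0 x1; field; rewrite x0 x1.
    by rewrite -(natr1 n.+1) gen// natr1 pnatr_eq0.
  rewrite lef_pV2 ?posrE ?mulr_gt0 ?exprn_gt0 ?ltr0n ?addnS//.
  by rewrite -natrM -natrX ler_nat; nia.
have sumF : (\sum_(n <oo) P (F n) < +oo)%E.
  apply: (@le_lt_trans _ _ c%:E); last exact: ltry.
  apply: lime_le; first by apply: is_cvg_nneseries => n _ _; exact: measure_ge0.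
  apply: nearW => n; rewrite /=.
  apply: (@le_trans _ _ (\sum_(0 <= i < n) (c * (i.+1%:R^-1 - i.+2%:R^-1))%:E)%E).
    by apply: lee_sum => i _.
  rewrite sumEFin lee_fin -mulr_sumr.
  have -> : \sum_(0 <= i < n) (i.+1%:R^-1 - i.+2%:R^-1) = 1 - n.+1%:R^-1 :> R.
    elim: n => [|n IHn]; first by rewrite big_nil invr1 subrr.
    by rewrite big_nat_recr//= IHn addrA subrK.
  by rewrite ler_piMr// gerBl invr_ge0.
have F0 := lim_sup_set_cvg0 mF sumF.
exists (lim_sup_set F); split => //.
  by apply: bigcap_measurable => // n _; exact: bigcup_measurable.
move=> t /= nA; apply: contrapT => /existsNP[n /not_implyP[_ nF]].
apply: nA; exists (n + N0.+2)%N => // N /= nN At; apply: nF.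
exists (N - N0.+2)%N => /=; first by lia.
by rewrite /F subnK//; lia.
Qed.

Lemma ae_no_tie d (T : measurableType d) (R : realType)
    (P : probability T R) (I : finType) (X : I -> {RV P >-> R}) :
  iid_standard_gaussian X -> \forall t \ae P, injective (fun i => X i t).
Proof.
move=> iidX.
have : \forall t \ae P, forall i j, i != j -> X i t <> X j t.
  apply: filter_forall => i; apply: filter_forall => j.
  have [ij|ij] := eqVneq i j; first by apply: aeW.
  have mS : measurable [set t | X i t = X j t].
    have -> : [set t | X i t = X j t] = (fun t => X i t - X j t) @^-1` [set 0].
      by apply/seteqP; split => t /= => [->|/subr0_eq]; rewrite ?subrr.
    rewrite -[X in measurable X]setTI.
    have m : measurable_fun [set: T] (fun t => X i t - X j t).
      exact: measurable_funB.
    exact: m.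
  exists [set t | X i t = X j t]; split => //; first exact: prob_tie.
  by move=> t /= h; apply: contrapT => h'; exact: h.
apply: filterS => t h i j /= e; apply/eqP; apply: contrapT => /negP ij.
exact: h ij e.
Qed.

(** * The two energy levels *)

(** A level that some site almost surely reaches: about N^eps sites are expected
    below the opposite of it.  The term ln N / 2 compensates the factor of
    order 1 / sqrt N of the Gaussian tail. *)
Definition ground_level {R : realType} (eps : R) (N : nat) : R :=
  Num.sqrt (2 * (N%:R * ln 2 - (2^-1 + eps) * ln N%:R)).

(** A level such that about k N^(- eps) sites are expected below its opposite. *)
Definition cut_level {R : realType} (eps : R) (N k : nat) : R :=
  Num.sqrt (2 * (N%:R * ln 2 - (2^-1 - eps) * ln N%:R - ln k%:R)).

Section levels.
Context (R : realType) (beta eps : R) (N k : nat).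
Hypotheses (beta_gt : beta_c R < beta) (eps_gt0 : 0 < eps) (eps_lt : eps < 2^-1).
Hypotheses (N_gt0 : (0 < N)%N) (N_le_k : (N <= k)%N).
Hypothesis lnk_le : ln k%:R <= ln 2 / 4 * N%:R :> R.

Let r : R := Num.sqrt N%:R.
Let u : R := ln N%:R.
Let kap : R := ln k%:R.
Let a : R := ground_level eps N.
Let b : R := cut_level eps N k.

Let ln2_gt0 : 0 < ln 2 :> R.
Proof. by rewrite ln_gt0// ltr1n. Qed.

Let bc_gt0 : 0 < beta_c R.
Proof. by rewrite sqrtr_gt0 mulr_gt0. Qed.

Let n_gt0 : 0 < N%:R :> R.
Proof. by rewrite ltr0n. Qed.

Let r_gt0 : 0 < r.
Proof. by rewrite sqrtr_gt0. Qed.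

Let rr : r ^+ 2 = N%:R.
Proof. by rewrite sqr_sqrtr// ltW. Qed.

Let bcbc : beta_c R ^+ 2 = 2 * ln 2.
Proof. by rewrite sqr_sqrtr// mulr_ge0// ltW. Qed.

Let k_gt0 : 0 < k%:R :> R.
Proof. by rewrite ltr0n (leq_trans N_gt0). Qed.

Let u_ge0 : 0 <= u.
Proof. by rewrite ln_ge0// ler1n. Qed.

Let u_le_kap : u <= kap.
Proof. by rewrite ler_ln ?posrE// ler_nat. Qed.

Let kap_le : kap <= ln 2 / 4 * N%:R.
Proof. exact: lnk_le. Qed.

Let eps_u_ge0 : 0 <= eps * u.
Proof. by rewrite mulr_ge0// ltW. Qed.

Let eps_u_le : eps * u <= 2^-1 * u.
Proof. by rewrite ler_wpM2r// ltW. Qed.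

Let n_ln2_gt0 : 0 < N%:R * ln 2 :> R.
Proof. exact: mulr_gt0. Qed.

Let exp_u : expR (u / 2) = r.
Proof.
apply: (@pexpIrn R 2) => //; rewrite ?nnegrE ?expR_ge0 ?ltW//.
by rewrite -expRM_natr divfK// rr lnK// posrE.
Qed.

Let exp_L : expR (N%:R * ln 2) = (2 ^ N)%:R :> R.
Proof. by rewrite expRM_natl lnK ?posrE// natrX. Qed.

Let aa : a ^+ 2 = 2 * (N%:R * ln 2 - (2^-1 + eps) * u).
Proof. rewrite sqr_sqrtr// -/u -/kap; move: eps_u_ge0 eps_u_le n_ln2_gt0 u_le_kap kap_le; lra. Qed.

Let bb : b ^+ 2 = 2 * (N%:R * ln 2 - (2^-1 - eps) * u - kap).
Proof. rewrite sqr_sqrtr// -/u -/kap; move: eps_u_ge0 eps_u_le n_ln2_gt0 u_le_kap kap_le; lra. Qed.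

Let a_ge0 : 0 <= a. Proof. exact: sqrtr_ge0. Qed.
Let b_ge0 : 0 <= b. Proof. exact: sqrtr_ge0. Qed.

Lemma ground_level_le : ground_level eps N <= beta_c R * Num.sqrt N%:R.
Proof.
rewrite -(@ler_pXn2r _ 2)// ?nnegrE ?mulr_ge0 ?sqrtr_ge0//.
rewrite -/a -/r exprMn rr bcbc aa; move: eps_u_ge0 eps_u_le n_ln2_gt0 u_le_kap kap_le u_ge0; lra.
Qed.

Lemma cut_level_le : cut_level eps N k <= beta_c R * Num.sqrt N%:R.
Proof.
rewrite -(@ler_pXn2r _ 2)// ?nnegrE ?mulr_ge0 ?sqrtr_ge0//.
rewrite -/b -/r exprMn rr bcbc bb; move: eps_u_ge0 eps_u_le n_ln2_gt0 u_le_kap kap_le u_ge0; lra.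
Qed.

(** The growth condition ln k <= (ln 2 / 4) N keeps b^2 / 2 above half of N ln 2. *)
Lemma cut_level_ge : beta_c R * Num.sqrt N%:R / 2 <= cut_level eps N k.
Proof.
rewrite -(@ler_pXn2r _ 2)// ?nnegrE ?mulr_ge0 ?sqrtr_ge0//.
rewrite -/b -/r !exprMn rr bcbc bb.
move: eps_u_ge0 eps_u_le n_ln2_gt0 u_le_kap kap_le; lra.
Qed.

Let b_gt0 : 0 < b.
Proof. by apply: lt_le_trans cut_level_ge; rewrite !mulr_gt0. Qed.

Lemma cut_level_gt0 : 0 < cut_level eps N k. Proof. exact: b_gt0. Qed.

Lemma cut_le_ground : cut_level eps N k <= ground_level eps N.
Proof.
rewrite -(@ler_pXn2r _ 2)// ?nnegrE//.
rewrite -/a -/b aa bb; move: eps_u_ge0 eps_u_le n_ln2_gt0 u_le_kap kap_le u_ge0; lra.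
Qed.

Lemma gap_le : (beta - beta_c R) * Num.sqrt N%:R <=
  beta * Num.sqrt N%:R - cut_level eps N k.
Proof. by rewrite mulrBl lerD2l lerN2 cut_level_le. Qed.

(** The factor sqrt N left over from the level cancels the bound
    a <= beta_c sqrt N on the denominator of the tail. *)
Lemma expected_ground : (beta_c R)^-1 * expR (eps * ln N%:R) <=
  (2 ^ N)%:R * (expR (- ground_level eps N ^+ 2 / 2) / ground_level eps N).
Proof.
have a_gt0 : 0 < a := lt_le_trans b_gt0 cut_le_ground.
rewrite -/a -/u -exp_L mulrA -expRD aa.
rewrite (_ : N%:R * ln 2 + _ / 2 = u / 2 + eps * u); last by field.
rewrite expRD exp_u mulrAC ler_pM2r ?expR_gt0//.
rewrite ler_pdivlMr// mulrC ler_pdivrMr// mulrC; exact: ground_level_le.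
Qed.

(** The factor sqrt N left over from the level cancels against the two decay
    rates, both of order sqrt N; for the second one this uses beta > beta_c. *)
Lemma expected_cut :
  (2 ^ N)%:R * (expR (- cut_level eps N k ^+ 2 / 2) *
    ((cut_level eps N k)^-1 + (beta * Num.sqrt N%:R - cut_level eps N k)^-1)) <=
  k%:R * (expR (- (eps * ln N%:R)) * (2 / beta_c R + (beta - beta_c R)^-1)).
Proof.
rewrite -/b -/u -/r -exp_L mulrA -expRD bb.
rewrite (_ : N%:R * ln 2 + _ / 2 = u / 2 + kap + (- (eps * u))); last by field.
rewrite !expRD exp_u lnK ?posrE// (mulrC r) -!mulrA ler_pM2l//.
rewrite mulrCA ler_pM2l ?expR_gt0// mulrDr; apply: lerD.
  rewrite ler_pdivrMr// mulrAC ler_pdivlMr//.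
  by have := cut_level_ge; rewrite -/b -/r; nra.
have g := gap_le; rewrite -/b -/r in g.
have d_gt0 : 0 < beta - beta_c R by rewrite subr_gt0.
have p : 0 < beta * r - b by apply: lt_le_trans g; exact: mulr_gt0.
by rewrite ler_pdivrMr// mulrC ler_pdivlMr// mulrC.
Qed.

(** Since a + b <= 2 beta_c sqrt N, the difference of the levels is at least
    (a^2 - b^2) / (2 beta_c sqrt N), and a^2 - b^2 is 2 (ln k - 2 eps ln N). *)
Lemma complement_weight : eps * (4 * (beta / beta_c R)) = beta / beta_c R - 1 ->
  k%:R * expR (- (beta * Num.sqrt N%:R * (ground_level eps N - cut_level eps N k))) <=
  expR (- ((beta / beta_c R - 1) / 2 * ln N%:R)).
Proof.
set theta := beta / beta_c R => epsE.
rewrite -/a -/b -/r -/u -{1}(@lnK _ k%:R) ?posrE// -/kap -expRD ler_expR.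
have th1 : 1 < theta by rewrite ltr_pdivlMr// mul1r.
have betaE : beta = theta * beta_c R by rewrite divfK// gt_eqF.
have ha : a <= beta_c R * r := ground_level_le.
have hb : b <= beta_c R * r := cut_level_le.
have hab : b <= a := cut_le_ground.
have sq : (a - b) * (a + b) = 2 * (kap - 2 * eps * u).
  by rewrite -subr_sqr aa bb; field.
have m0 : 0 < beta_c R * r by exact: mulr_gt0.
have : kap - 2 * eps * u <= beta_c R * r * (a - b) by nra.
rewrite betaE => h.
have : theta * (kap - 2 * eps * u) <= theta * (beta_c R * r * (a - b)).
  by rewrite ler_pM2l//; lra.
have : eps * (4 * theta) * u = (theta - 1) * u by rewrite epsE.
have : 0 <= (theta - 1) * (kap - u) by apply: mulr_ge0; rewrite subr_ge0// ltW.
lra.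
Qed.

End levels.

(** * The exceptional events and the conclusion *)

(** No site reaches the level [- a], or the cut weights add up to at least [k]. *)
Definition bad_event {d} {T : measurableType d} {R : realType}
    {P : probability T R} (lam a b : R) {N : nat} (k : nat)
    (X : 'I_(2 ^ N) -> {RV P >-> R}) : set T :=
  \bigcap_(i in [set` [set: 'I_(2 ^ N)]%SET]) (X i @^-1` `](- a)%R, +oo[) `|`
  [set t | k%:R <= \sum_i cut_weight lam b (X i t)].

Lemma measurable_bad_event d (T : measurableType d) (R : realType)
    (P : probability T R) (lam a b : R) (N k : nat)
    (X : 'I_(2 ^ N) -> {RV P >-> R}) :
  measurable (bad_event lam a b k X).
Proof.
apply: measurableU.
  by apply: fin_bigcap_measurable => // i _; exact: measurable_preimage_RV.
by apply: measurable_sum_ge; exact: measurable_cut_weight.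
Qed.

Lemma bad_event_prob d (T : measurableType d) (R : realType)
    (P : probability T R) (lam a b m : R) (N k : nat)
    (X : 'I_(2 ^ N) -> {RV P >-> R}) :
  iid_standard_gaussian X -> 1 <= a -> 0 < b -> b < lam ->
  2 * m <= (2 ^ N)%:R *
    (normal_peak 1 * expR (- 2) * (expR (- a ^+ 2 / 2) / a)) ->
  (2 ^ N)%:R * (expR (- b ^+ 2 / 2) * (b^-1 + (lam - b)^-1)) <= k%:R / 4 ->
  8 * m <= k%:R ->
  (P (bad_event lam a b k X) <= (2 * expR (- (2 * m)))%:E)%E.
Proof.
move=> [indepX gX] a1 b0 blam hp he hk.
apply: le_trans (measureU2 P _ _) _.
- by apply: fin_bigcap_measurable => // i _; exact: measurable_preimage_RV.
- by apply: measurable_sum_ge; exact: measurable_cut_weight.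
rewrite mulrDl mul1r EFinD; apply: leeD.
  apply: le_trans (@prob_all_gt _ _ _ _ _ X (- a) _ indepX _) _.
    by move=> i; apply: gaussian_lower_tail.
  by rewrite lee_fin ler_expR lerN2 card_ord.
apply: le_trans (@chernoff_sum _ _ _ _ _ X (cut_weight lam b) _ k%:R indepX _ _ _) _.
- exact: measurable_cut_weight.
- by move=> x; rewrite cut_weight_ge0 cut_weight_le1.
- by move=> i; exact: gaussian_cut_weight.
by rewrite lee_fin ler_expR card_ord; lra.
Qed.

Lemma good_event_gibbs d (T : measurableType d) (R : realType)
    (P : probability T R) (beta a b : R) (N k : nat) (sigma : 'I_(2 ^ N) -> config N)
    (X : 'I_(2 ^ N) -> {RV P >-> R}) (t : T) :
  0 <= beta -> injective (fun i => X i t) ->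
  ~ bad_event (beta * Num.sqrt N%:R) a b k X t ->
  gibbs beta sigma (fun i => X i t)
    (~: lowest_configs sigma (fun i => X i t) k)%SET <=
  k%:R * expR (- (beta * Num.sqrt N%:R * (a - b))).
Proof.
move=> beta0 injX nbad; apply: gibbs_complement_le => //.
- by rewrite mulr_ge0// sqrtr_ge0.
- by rewrite ltW// ltNge; apply/negP => h; apply: nbad; right.
- apply: contrapT => /forallNP h; apply: nbad; left => i _ /=.
  by rewrite in_itv/= andbT ltNge; apply/negP; exact: h.
Qed.

Lemma near_ln_ge (R : realType) (M : R) : \forall N \near \oo, M <= ln N%:R.
Proof.
near=> N.
rewrite -[leLHS]expRK ler_ln ?posrE ?expR_gt0//; near: N.
  exact: nbhs_infty_ger.
near=> N; rewrite ltr0n; near: N; exact: nbhs_infty_gt.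
Unshelve. all: by end_near. Qed.

Lemma sqr_le_expR (R : realType) (x : R) : 0 <= x -> x ^+ 2 / 4 <= expR x.
Proof.
move=> x0; have -> : expR x = expR (x / 2) ^+ 2.
  by rewrite -expRM_natr divfK.
have := expR_ge1Dx (x / 2); nra.
Qed.

Lemma cvg_expRN_ln (R : realType) (c : R) : 0 < c ->
  expR (- (c * ln N%:R)) @[N --> \oo] --> (0 : R).
Proof.
move=> c0; apply/cvgr0Pnorm_le => e e0; near=> N.
rewrite ger0_norm ?expR_ge0// -[leRHS]lnK ?posrE// ler_expR lerNl.
rewrite -ler_pdivrMl// mulrC; near: N; exact: near_ln_ge.
Unshelve. all: by end_near. Qed.

(** As ln N >= 1 for large N, the second limit bounds ln k / N as well. *)
Lemma near_cut_regime (R : realType) (k : nat -> nat) (M : R) :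
  ((k N)%:R / N%:R : R) @[N --> \oo] --> +oo ->
  (ln (k N)%:R * ln N%:R / N%:R : R) @[N --> \oo] --> (0 : R) ->
  \forall N \near \oo, [/\ (0 < N)%N, 8 * N%:R <= (k N)%:R :> R,
    ln (k N)%:R <= ln 2 / 4 * N%:R :> R & M <= ln N%:R].
Proof.
move=> /cvgryPge kdiv /cvgr0Pnorm_le klog.
near=> N.
have N0 : (0 < N)%N by near: N; exact: nbhs_infty_gt.
have n0 : 0 < N%:R :> R by rewrite ltr0n.
have k8 : 8 * N%:R <= (k N)%:R :> R.
  by rewrite -ler_pdivlMr//; near: N; exact: kdiv.
have lnN : 1 <= ln N%:R :> R by near: N; exact: near_ln_ge.
split => //; last by near: N; exact: near_ln_ge.
have : `|ln (k N)%:R * ln N%:R / N%:R| <= ln 2 / 4 :> R.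
  by near: N; apply: klog; rewrite divr_gt0// ln_gt0// ltr1n.
move=> /(le_trans (ler_norm _)); rewrite ler_pdivrMr//; apply: le_trans.
rewrite ler_peMr// ln_ge0//; apply: le_trans k8.
have : 1 <= N%:R :> R by rewrite ler1n.
lra.
Unshelve. all: by end_near. Qed.

Lemma near_bad_event_prob d (T : measurableType d) (R : realType)
    (P : probability T R) (X : forall N : nat, 'I_(2 ^ N) -> {RV P >-> R})
    (beta eps : R) (k : nat -> nat) :
  (forall N : nat, (0 < N)%N -> iid_standard_gaussian (X N)) ->
  beta_c R < beta -> 0 < eps -> eps < 2^-1 ->
  ((k N)%:R / N%:R : R) @[N --> \oo] --> +oo ->
  (ln (k N)%:R * ln N%:R / N%:R : R) @[N --> \oo] --> (0 : R) ->
  \forall N \near \oo, (P (bad_event (beta * Num.sqrt N%:R)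
    (ground_level eps N) (cut_level eps N (k N)) (k N) (X N)) <=
    (2 / N%:R ^+ 2)%:E)%E.
Proof.
move=> X_iid beta_gt eps0 eps1 kdiv klog.
have bc0 : 0 < beta_c R by rewrite sqrtr_gt0 mulr_gt0// ln_gt0// ltr1n.
have d0 : 0 < beta - beta_c R by rewrite subr_gt0.
pose c0 : R := normal_peak 1 * expR (- 2) / beta_c R.
have c0_gt0 : 0 < c0 by rewrite divr_gt0// mulr_gt0 ?expR_gt0// normal_peak_gt0.
pose K : R := 2 / beta_c R + (beta - beta_c R)^-1.
near=> N.
have [N0 k8 lnk _] : [/\ (0 < N)%N, 8 * N%:R <= (k N)%:R :> R,
    ln (k N)%:R <= ln 2 / 4 * N%:R :> R & (0 : R) <= ln N%:R].
  by near: N; exact: near_cut_regime.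
have n0 : 0 < N%:R :> R by rewrite ltr0n.
have Nk : (N <= k N)%N by rewrite -(ler_nat R); lra.
have u1 : 1 <= ln N%:R :> R by near: N; exact: near_ln_ge.
(* [u2] gives 2 u <= c0 * (eps u)^2 / 4, [u3] gives 4 K <= exp (eps u), and
   [u4] gives 2 / beta_c <= sqrt N, so that both levels are at least 1. *)
have u2 : 8 / (c0 * eps ^+ 2) <= ln N%:R :> R by near: N; exact: near_ln_ge.
have u3 : 4 * K / eps <= ln N%:R :> R by near: N; exact: near_ln_ge.
have u4 : ln ((2 / beta_c R) ^+ 2) <= ln N%:R :> R by near: N; exact: near_ln_ge.
set u : R := ln N%:R in u1 u2 u3 u4.
have u0 : 0 <= u by lra.
have bN := @cut_level_ge R eps N (k N) eps0 eps1 N0 Nk lnk.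
have b0 := @cut_level_gt0 R eps N (k N) eps0 eps1 N0 Nk lnk.
have ba := @cut_le_ground R eps N (k N) eps0 eps1 N0 Nk lnk.
have r0 : 0 < Num.sqrt N%:R :> R by rewrite sqrtr_gt0.
have b1 : 1 <= cut_level eps N (k N).
  apply: le_trans bN.
  have : 2 / beta_c R <= Num.sqrt N%:R.
    rewrite -(@ler_pXn2r _ 2)// ?nnegrE ?divr_ge0 ?sqrtr_ge0//.
    rewrite sqr_sqrtr; last exact: ltW.
    by move: u4; rewrite /u ler_ln ?posrE ?exprn_gt0 ?divr_gt0.
  by rewrite ler_pdivrMr// ler_pdivlMr// mul1r mulrC.
have gap := @gap_le R beta eps N (k N) eps0 eps1 N0 Nk lnk.
apply: le_trans (@bad_event_prob _ _ _ _ _ _ _ u _ _ _ (X_iid N N0) _ _ _ _ _ _) _ => //.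
- exact: le_trans ba.
- by rewrite -subr_gt0; apply: lt_le_trans gap; exact: mulr_gt0.
- apply: (@le_trans _ _ (c0 * expR (eps * u))).
    apply: (@le_trans _ _ (c0 * ((eps * u) ^+ 2 / 4))); last first.
      apply: ler_wpM2l; first exact: ltW.
      by apply: sqr_le_expR; rewrite mulr_ge0// ltW.
    move: u2; rewrite ler_pdivrMr; last by rewrite mulr_gt0// exprn_gt0.
    move=> /(ler_wpM2r u0); rewrite exprMn; lra.
  have := @expected_ground R eps N (k N) eps0 eps1 N0 Nk lnk.
  have q0 : 0 <= normal_peak (1 : R) * expR (- 2) by rewrite mulr_ge0 ?normal_peak_ge0 ?expR_ge0.
  move=> /(ler_wpM2l q0) h; rewrite [leRHS]mulrCA; apply: le_trans h.
  by rewrite -/u mulrA.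
- apply: le_trans (@expected_cut R beta eps N (k N) beta_gt eps0 eps1 N0 Nk lnk) _.
  rewrite -/u -/K ler_wpM2l// expRN mulrC ler_pdivrMr ?expR_gt0//.
  have := expR_ge1Dx (eps * u).
  by move: u3; rewrite ler_pdivrMr//; lra.
- by apply: le_trans k8; rewrite ler_pM2l// ltW// ln_sublinear.
rewrite lee_fin ler_pM2l// expRN (_ : expR (2 * u) = N%:R ^+ 2)//.
by rewrite expRM_natl lnK.
Unshelve. all: by end_near. Qed.

Theorem mainTheorem6 (d : measure_display) (Omega : measurableType d)
  (R : realType) (P : probability Omega R)
  (sigma : forall N : nat, 'I_(2 ^ N) -> config N)
  (sigma_enum : forall N : nat, (0 < N)%N -> bijective (sigma N))
  (X : forall N : nat, 'I_(2 ^ N) -> {RV P >-> R})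
  (X_iid : forall N : nat, (0 < N)%N -> iid_standard_gaussian (X N))
  (beta : R) (beta_gt : beta_c R < beta)
  (k : nat -> nat) (k_gt0 : forall N : nat, (0 < N)%N -> (0 < k N)%N)
  (k_infty : k N @[N --> \oo] --> \oo)
  (k_div_infty : ((k N)%:R / N%:R : R) @[N --> \oo] --> +oo)
  (k_log_0 : (ln (k N)%:R * ln N%:R / N%:R : R) @[N --> \oo] --> (0 : R)) :
  \forall w \ae P,
    limn_esup (fun N : nat =>
      (gibbs beta (sigma N) (fun i => X N i w)
         (~: lowest_configs (sigma N) (fun i => X N i w) (k N)))%:E) = 0%E.
Proof.
have bc0 : 0 < beta_c R by rewrite sqrtr_gt0 mulr_gt0// ln_gt0// ltr1n.
have beta0 : 0 < beta by exact: lt_trans beta_gt.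
pose theta := beta / beta_c R.
have th1 : 1 < theta by rewrite ltr_pdivlMr// mul1r.
pose eps := (theta - 1) / (4 * theta).
have epsE : eps * (4 * theta) = theta - 1 by rewrite divfK// gt_eqF//; lra.
have eps0 : 0 < eps by apply: divr_gt0; lra.
have eps1 : eps < 2^-1 by rewrite ltr_pdivrMr; lra.
pose A N := bad_event (beta * Num.sqrt N%:R)
    (ground_level eps N) (cut_level eps N (k N)) (k N) (X N).
have aeA : \forall w \ae P, \forall N \near \oo, ~ A N w.
  apply: (@borel_cantelli_inv_sqr _ _ _ _ _ 2).
    by move=> N; exact: measurable_bad_event.
  exact: near_bad_event_prob.
(* The families are Gaussian only from N = 1 on, hence the successor. *)
have aeI : \forall w \ae P, forall N, injective (fun i => X N.+1 i w).
  by apply: ae_foralln => N; apply: ae_no_tie; exact: X_iid.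
apply: filterS2 aeA aeI => w nA inj.
apply: (cvg_limn_einf_sup _).2.
apply: cvg_EFin; first exact: nearW.
apply: (@squeeze_cvgr _ _ _ _ (fun=> 0) (fun N => expR (- ((theta - 1) / 2 * ln N%:R)))).
- near=> N; rewrite /=; apply/andP; split.
    apply: sumr_ge0 => i _; apply: divr_ge0; first exact: expR_ge0.
    by apply: sumr_ge0 => l _; exact: expR_ge0.
  have [N0 k8 lnk _] : [/\ (0 < N)%N, 8 * N%:R <= (k N)%:R :> R,
      ln (k N)%:R <= ln 2 / 4 * N%:R :> R & (0 : R) <= ln N%:R].
    by near: N; exact: near_cut_regime.
  have n0 : 0 < N%:R :> R by rewrite ltr0n.
  have Nk : (N <= k N)%N by rewrite -(ler_nat R); lra.
  apply: le_trans (@complement_weight R beta eps N (k N) beta_gt eps0 eps1 N0 Nk lnk epsE).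
  apply: good_event_gibbs; first exact: ltW.
    by rewrite -(prednK N0); exact: inj.
  by near: N; exact: nA.
- exact: cvg_cst.
- by apply: cvg_expRN_ln; lra.
Unshelve. all: by end_near. Qed.
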